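(* Let $\mathcal{O}$ be the ring of $S$-integers in a number field $K$, let $A,B,C\in\mathcal{O}$ with $A\neq 0$, and let $\mathcal{B}=\{\beta,\beta^*\}$ be the multi-set of roots of $Ax^2+Bx+C$. Let $N\ge 0$, $k\ge 1$. Then the polynomials $E_{21},E_{22}$ define a fibration (a morphism) from the PCF variety to the Fermat-Pell conic $$\pi_{\mathrm{FP}}:V(\mathcal{B})_{N,k}\longrightarrow \mathrm{FP}_k(\mathcal{B}),$$ $$\pi_{\mathrm{FP}}(b_1,\ldots,b_N,a_1,\ldots,a_k)=\bigl(E_{21}(b_1,\ldots,b_N,a_1,\ldots,a_k),\,E_{22}(b_1,\ldots,b_N,a_1,\ldots,a_k)\bigr).$$
   Context: Put $D(c)=\begin{bmatrix}c&1\\1&0\end{bmatrix}$ and $M([c_1,\ldots,c_n])=D(c_1)\cdots D(c_n)$ (the identity if $n=0$). For $N\ge0$, $k\ge1$ and variables $y_1,\ldots,y_N,x_1,\ldots,x_k$ let $$E_{N,k}=\begin{bmatrix}E_{11}&E_{12}\\ E_{21}&E_{22}\end{bmatrix}=M([y_1,\ldots,y_N])\,M([x_1,\ldots,x_k])\,M([y_1,\ldots,y_N])^{-1},$$ whose entries lie in $\mathbb{Z}[y_1,\ldots,y_N,x_1,\ldots,x_k]$. For $A,B,C\in\mathcal{O}$ not all zero, with $\mathcal{B}$ the multi-set of roots of $Ax^2+Bx+C$, the PCF variety $V(\mathcal{B})_{N,k}\subseteq\mathbb{A}^N\times\mathbb{A}^k$ is the affine variety over $\mathcal{O}$ defined by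 the three equations $$A(E_{22}-E_{11})=BE_{21},\qquad -AE_{12}=CE_{21},\qquad -BE_{12}=C(E_{22}-E_{11}).$$ For $A\ne0$ the Fermat-Pell conic $\mathrm{FP}_k(\mathcal{B})$ is the plane curve over $\mathcal{O}$ in coordinates $(x,y)$ given by $$A(x\beta+y)(x\beta^*+y)=Cx^2-Bxy+Ay^2=(-1)^kA.$$ ''Fibration'' here means just the morphism given by the stated formula; no surjectivity is asserted. *)

(* Defs.v *)
From HB Require Import structures.
From mathcomp Require Import all_boot all_order all_algebra all_field.
From mathcomp Require Import boolp classical_sets cardinality.
From mathcomp Require Import mpoly ring.

Set Implicit Arguments.
Unset Strict Implicit.
Unset Printing Implicit Defensive.

Import Order.TTheory GRing.Theory Num.Theory.
Local Open Scope ring_scope.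

(* The finite places of a number field are its normalized discrete valuations
   K^* ->> Z.  The value at 0 (mathematically +oo) is fixed to the junk value 0
   so that equal places are equal as records. *)
Record finite_place (K : fieldType) := FinitePlace {
  place_val :> K -> int;
  place_val0 : place_val 0 = 0;
  place_valM : forall x y, x != 0 -> y != 0 ->
    place_val (x * y) = place_val x + place_val y;
  place_valD : forall x y, x != 0 -> y != 0 -> x + y != 0 ->
    Num.min (place_val x) (place_val y) <= place_val (x + y);
  place_val_norm : exists2 x, x != 0 & place_val x = 1
}.

(* S consists of the finite places of the usual finite set of places; the
   archimedean ones always belong to the latter and impose no condition. *)
Definition is_S_integer (K : fieldType) (S : set (finite_place K)) : {pred K} :=
  fun x => `[< forall v : finite_place K, ~ S v -> x != 0 -> 0 <= v x >].

Section SIntegersRing.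
Variables (K : fieldType) (S : set (finite_place K)).

Fact place_val1 (v : finite_place K) : v 1 = 0.
Proof.
have := place_valM v (oner_neq0 K) (oner_neq0 K); rewrite mulr1 => h.
by apply: (addrI (v 1)); rewrite -h addr0.
Qed.

Fact place_valN (v : finite_place K) x : x != 0 -> v (- x) = v x.
Proof.
have n1 : (-1 : K) != 0 by rewrite oppr_eq0 oner_neq0.
have h : v (-1) = 0.
  have := place_valM v n1 n1; rewrite mulrNN mulr1 place_val1 => /esym/eqP.
  by rewrite -mulr2n mulrn_eq0 => /eqP.
by move=> x0; rewrite -mulN1r place_valM// h add0r.
Qed.

Fact is_S_integer_subring : subring_closed (is_S_integer S).
Proof.
split=> [|x y /asboolP hx /asboolP hy|x y /asboolP hx /asboolP hy].
- by apply/asboolP => v _ _; rewrite place_val1.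
- apply/asboolP => v Sv xy0.
  have [x0|x0] := eqVneq x 0.
    move: xy0; rewrite x0 sub0r oppr_eq0 => y0.
    by rewrite place_valN// hy.
  have [y0|y0] := eqVneq y 0; first by rewrite y0 subr0 hx.
  have ny0 : - y != 0 by rewrite oppr_eq0.
  apply: (le_trans _ (place_valD v x0 ny0 xy0)).
  by rewrite le_min hx// place_valN// hy.
- apply/asboolP => v Sv; rewrite mulf_eq0 negb_or => /andP[x0 y0].
  by rewrite place_valM// addr_ge0// ?hx// hy.
Qed.

HB.instance Definition _ :=
  GRing.isSubringClosed.Build K (is_S_integer S) is_S_integer_subring.

Record S_integers := SIntegers {
  S_integers_val :> K; _ : S_integers_val \in is_S_integer S }.

HB.instance Definition _ := [isSub for S_integers_val].
HB.instance Definition _ := [Choice of S_integers by <:].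
HB.instance Definition _ := [SubChoice_isSubComNzRing of S_integers by <:].

End SIntegersRing.

Section Affine.
Variable R : comNzRingType.

(* A closed subscheme of the affine space A^n over R, given by its equations;
   its coordinate ring is R[X_1, ..., X_n] modulo the ideal they generate. *)
Definition affine_variety (n : nat) := seq {mpoly R[n]}.

Definition in_ideal n (X : affine_variety n) (p : {mpoly R[n]}) : Prop :=
  exists c : 'I_(size X) -> {mpoly R[n]}, p = \sum_(i < size X) c i * X`_i.

(* The polynomials phi_1, ..., phi_m define a morphism X -> Y over R when the
   substitution p |-> p(phi_1, ..., phi_m) passes to the quotient, i.e. induces
   an R-algebra morphism R[Y] -> R[X] between coordinate rings. *)
Definition defines_morphism n m (X : affine_variety n) (Y : affine_variety m)
    (phi : m.-tuple {mpoly R[n]}) : Prop :=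
  forall p, in_ideal Y p -> in_ideal X (p \mPo phi).

Definition is_point n (T : comNzRingType) (f : {rmorphism R -> T})
    (X : affine_variety n) (t : 'I_n -> T) : Prop :=
  forall p, p \in X -> mmap f t p = 0.

Lemma in_ideal_point n (T : comNzRingType) (f : {rmorphism R -> T}) (X : affine_variety n) t p :
  is_point f X t -> in_ideal X p -> mmap f t p = 0.
Proof.
move=> Xt [c ->]; rewrite raddf_sum big1//= => i _.
by rewrite rmorphM/= (Xt _ (mem_nth _ (ltn_ord i))) mulr0.
Qed.

Lemma defines_morphism_point n m (X : affine_variety n) (Y : affine_variety m)
    phi (T : comNzRingType) (f : {rmorphism R -> T}) (t : 'I_n -> T) :
  defines_morphism X Y phi -> is_point f X t ->
  is_point f Y (fun j => mmap f t (tnth phi j)).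
Proof.
move=> XY Xt p Yp.
have Ip : in_ideal Y p.
  have ip : (index p Y < size Y)%N by rewrite index_mem.
  exists (fun i => (i == Ordinal ip)%:R).
  rewrite (bigD1 (Ordinal ip))//= eqxx mul1r nth_index// big1 ?addr0// => i.
  by move=> /negPf->; rewrite mul0r.
rewrite -[RHS](in_ideal_point Xt (XY p Ip)) comp_mpolyE.
rewrite raddf_sum /=; apply: eq_bigr => a _.
rewrite [RHS]mmapZ (rmorph_prod (mmap f t)); congr (_ * _).
by apply: eq_bigr => i _; rewrite (rmorphXn (mmap f t)).
Qed.

End Affine.

Definition Dmx (R : comNzRingType) (c : R) : 'M[R]_2 :=
  \matrix_(i < 2, j < 2) (nth [::] [:: [:: c; 1]; [:: 1; 0]] i)`_j.

Definition Mmx (R : comNzRingType) (s : seq R) : 'M[R]_2 :=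
  foldr (fun c P => Dmx c *m P) 1%:M s.

Lemma det_Dmx (R : comNzRingType) (c : R) : \det (Dmx c) = -1.
Proof.
rewrite (expand_det_row _ ord0) !big_ord_recl big_ord0 /cofactor !det_mx11.
by rewrite !mxE/= /bump /=; ring.
Qed.

Lemma det_Mmx (R : comNzRingType) (s : seq R) : \det (Mmx s) = (-1) ^+ size s.
Proof.
by elim: s => [|c s ih] /=; rewrite ?det1// det_mulmx det_Dmx ih -exprS.
Qed.

(* In particular invmx below is the inverse. *)
Lemma Mmx_unit (R : comUnitRingType) (s : seq R) : Mmx s \in unitmx.
Proof. by rewrite unitmxE det_Mmx unitrX// unitrN1. Qed.

(* The variables of Z[y_1, ..., y_N, x_1, ..., x_k]: first the y's, then the
   x's. *)
Definition yvars N k : seq {mpoly int[N + k]} :=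
  [seq 'X_(lshift k i) | i <- enum 'I_N].
Definition xvars N k : seq {mpoly int[N + k]} :=
  [seq 'X_(rshift N j) | j <- enum 'I_k].

Definition Emx N k : 'M[{mpoly int[N + k]}]_2 :=
  Mmx (yvars N k) *m Mmx (xvars N k) *m invmx (Mmx (yvars N k)).

Section Varieties.
Variable R : comNzRingType.

(* E_(N,k) viewed with coefficients in R; rows and columns are numbered from
   0, so E_21 is EmxR N k 1 0. *)
Definition EmxR N k : 'M[{mpoly R[N + k]}]_2 :=
  map_mx (map_mpoly (intr : int -> R)) (Emx N k).

Definition PCF_variety (A B C : R) N k : affine_variety R (N + k) :=
  let E11 := EmxR N k 0 0 in let E12 := EmxR N k 0 1 in
  let E21 := EmxR N k 1 0 in let E22 := EmxR N k 1 1 in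
  [:: A *: (E22 - E11) - B *: E21;
      - (A *: E12) - C *: E21;
      - (B *: E12) - C *: (E22 - E11)].

Definition FP_form (A B C : R) : {mpoly R[2]} :=
  let x := 'X_0 in let y := 'X_1 in
  C *: x ^+ 2 - B *: (x * y) + A *: y ^+ 2.

Definition FP_conic (A B C : R) k : affine_variety R 2 :=
  [:: FP_form A B C - ((-1) ^+ k * A)%:MP].

Definition pi_FP N k : 2.-tuple {mpoly R[N + k]} :=
  [tuple EmxR N k 1 0; EmxR N k 1 1].

(* {b, b'} is the multi-set of roots, in an extension field L, of
   A X^2 + B X + C (for A != 0). *)
Definition is_root_multiset (L : fieldType) (f : R -> L)
    (A B C : R) (b b' : L) : Prop :=
  map_poly f (A *: 'X^2 + B *: 'X + C%:P) =
  f A *: (('X - b%:P) * ('X - b'%:P)).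

Lemma FP_form_factor (L : fieldType) (f : {rmorphism R -> L}) A B C b b' :
  is_root_multiset f A B C b b' ->
  map_mpoly f (FP_form A B C) =
  f A *: (('X_0 * b%:MP + 'X_1) * ('X_0 * b'%:MP + 'X_1)).
Proof.
rewrite /is_root_multiset.
have -> : ('X - b%:P) * ('X - b'%:P) = 'X^2 - (b + b') *: 'X + (b * b')%:P.
  by rewrite -mul_polyC polyCD polyCM; ring.
move=> h; have e i : f (A *: 'X^2 + B *: 'X + C%:P)`_i =
    (f A *: ('X^2 - (b + b') *: 'X + (b * b')%:P))`_i by rewrite -coef_map h.
have := e 0; rewrite !coefE/= !mulr0 !add0r ?addr0 ?oppr0 ?add0r => eC.
have := e 1; rewrite !coefE/= !mulr0 ?mulr1 !add0r ?addr0 => eB.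
have {h e eC eB} [eC eB] : f C = f A * (b * b') /\ f B = - (f A * (b + b')).
  by split=> //; rewrite eB mulrN.
rewrite /FP_form !(rmorphD, rmorphB, rmorphN)/= !map_mpolyZ.
rewrite !expr2 !rmorphM/= !map_mpolyX.
rewrite eC eB -!mul_mpolyC; rewrite !(mpolyCM, mpolyCD, mpolyCN).
ring.
Qed.

End Varieties.

(* Main.v *)
(** Conjugation preserves determinants, so E has determinant (-1)^k. Writing
    (-1)^k A as A (E11 E22 - E12 E21), the equation of the conic at
    (x, y) = (E21, E22) becomes E22 g1 - E21 g2, where g1 and g2 are the first
    two equations of the PCF variety. *)

Require Import Defs.
From HB Require Import structures.
From mathcomp Require Import all_boot all_order all_algebra all_field.
From mathcomp Require Import boolp classical_sets cardinality.
From mathcomp Require Import mpoly ring.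

Set Implicit Arguments.
Unset Strict Implicit.
Unset Printing Implicit Defensive.

Import GRing.Theory.
Local Open Scope ring_scope.

Lemma det_Emx N k : \det (Emx N k) = (-1) ^+ k.
Proof.
rewrite /Emx !det_mulmx mulrAC -det_mulmx mulmxV ?Mmx_unit// det1 mul1r.
by rewrite det_Mmx size_map size_enum_ord.
Qed.

Lemma det_mx22 (R : comNzRingType) (M : 'M[R]_2) :
  \det M = M 0 0 * M 1 1 - M 0 1 * M 1 0.
Proof.
rewrite (expand_det_row _ 0) !big_ord_recl big_ord0 /cofactor !det_mx11 !mxE.
rewrite (_ : lift 0 0 = 1); last exact/val_inj.
rewrite (_ : lift 1 0 = 0); last exact/val_inj.
by rewrite /=; ring.
Qed.

(** Determinants commute with the coefficient map from the integers to [R], so the integral identity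
    carries over. *)
Lemma EmxR_det (R : comNzRingType) N k :
  EmxR R N k 0 0 * EmxR R N k 1 1 - EmxR R N k 0 1 * EmxR R N k 1 0 =
  (-1) ^+ k.
Proof.
by rewrite -det_mx22 /EmxR det_map_mx det_Emx rmorphXn/= rmorphN1.
Qed.

Lemma in_ideal_mull (R : comNzRingType) n (X : affine_variety R n) p q :
  in_ideal X q -> in_ideal X (p * q).
Proof.
case=> c ->; exists (fun i => p * c i); rewrite mulr_sumr.
by apply: eq_bigr => i _; rewrite mulrA.
Qed.

(** Substitution is a ring morphism, so it sends multiples of [q] to multiples of [q \mPo phi];
    checking the single generator suffices. *)
Lemma defines_morphism_hypersurface (R : comNzRingType) n m
    (X : affine_variety R n) (q : {mpoly R[m]}) phi :
  in_ideal X (q \mPo phi) -> defines_morphism X [:: q] phi.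
Proof.
move=> Xq p [c ->]; rewrite big_ord1 rmorphM/=.
exact: in_ideal_mull.
Qed.

Lemma pi_FP_morphism (R : comNzRingType) (A B C : R) N k :
  defines_morphism (PCF_variety A B C N k) (FP_conic A B C k) (pi_FP R N k).
Proof.
apply: defines_morphism_hypersurface.
(* With these coefficients the combination expands to the conic form at (E21, E22) minus A (E11 E22
   - E12 E21). *)
exists (fun i => [:: EmxR R N k 1 1; - EmxR R N k 1 0; 0]`_i).
rewrite !big_ord_recl big_ord0 /= mul0r !addr0.
(* The sign is split off from [A] so that it can be traded for the determinant after
   substitution. *)
have -> : ((-1) ^+ k * A)%:MP_[2] = (-1) ^+ k * A%:MP_[2].
  by rewrite mpolyCM rmorphXn/= mpolyCN mpolyC1.
rewrite /FP_form.
rewrite !(rmorphB, rmorphD)/= !comp_mpolyZ !expr2 !rmorphM/= !comp_mpolyC.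
(* Once the sign is the determinant, what remains is a polynomial identity in the four entries of
   E. *)
rewrite rmorphXn/= rmorphN1 -(EmxR_det R N k) !comp_mpolyXU /=.
rewrite -!mul_mpolyC; ring.
Qed.

Theorem theorem3p5 (K : fieldExtType rat)
    (S : set (finite_place K)) (finS : finite_set S)
    (A B C : S_integers S) (A_neq0 : A != 0)
    (L : fieldType) (f : {rmorphism K -> L}) (beta beta' : L)
    (roots : is_root_multiset (f \o val) A B C beta beta')
    (N k : nat) (k_ge1 : (1 <= k)%N) :
  defines_morphism (PCF_variety A B C N k) (FP_conic A B C k)
    (pi_FP (S_integers S) N k).
Proof. exact: pi_FP_morphism. Qed.
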